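(* Let $X$ be a Hadamard space, $C\subseteq X$ closed and convex, $\alpha>1$, and let $T:C\to C$ be an $\alpha$-Lipschitz, demiclosed and quasi-nonexpansive mapping. Let $\{\lambda_k\}$ be a sequence with $0<\lambda_k<\frac1{\alpha-1}$ for all $k$ and $\liminf_k\lambda_k>0$, let $u,x_1\in C$, and let $\{\alpha_k\}\subset(0,1)$ satisfy $\lim_k\alpha_k=0$ and $\sum_{k=1}^\infty\alpha_k=+\infty$. Then the sequence $\{x_k\}$ generated by $$x_{k+1}=\alpha_ku\oplus(1-\alpha_k)J^T_{\lambda_k}x_k\qquad(k\ge1)$$ converges strongly (i.e. in the metric) to $\mathrm{Proj}_{F(T)}u$.
   Context: A Hadamard space is a complete CAT(0) space. $(1-t)x\oplus ty$ denotes the unique point $z$ of the geodesic segment $[x,y]$ with $d(x,z)=t\,d(x,y)$ and $d(y,z)=(1-t)d(x,y)$. $\mathrm{Proj}_S u$ is the nearest point of a nonempty closed convex set $S$ to $u$. For a bounded sequence $\{x_k\}$ the asymptotic center is the set of minimizers over $x\in X$ of $\limsup_k d(x,x_k)$. $\{x_k\}$ $\Delta$-converges to $x$ if every subsequence of $\{x_k\}$ has asymptotic center $\{x\}$. $F(T)=\{x\in C:Tx=x\}$. $T$ is $\alpha$-Lipschitz if $d(Tx,Ty)\le\alpha d(x,y)$ for all $x,y\in C$. $T$ is quasi-nonexpansive if $F(T)\neq\varnothing$ and $d(Tx,q)\le d(x,q)$ for all $x\in C$, $q\in F(T)$ (then $F(T)$ is closed and convex). $T$ is demiclosed if, whenever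 $\{x_k\}\subset C$ $\Delta$-converges to $x$ and $d(x_k,Tx_k)\to0$, one has $x\in F(T)$. For $0<\lambda<\frac1{\alpha-1}$ and $x\in C$, the map $y\mapsto\frac1{1+\lambda}x\oplus\frac{\lambda}{1+\lambda}Ty$ is a contraction of $C$; its unique fixed point is denoted $J^T_\lambda x$ (the resolvent), so $J^T_\lambda x=\frac1{1+\lambda}x\oplus\frac{\lambda}{1+\lambda}T(J^T_\lambda x)$. *)

(* Defs.v *)
From HB Require Import structures.
From mathcomp Require Import all_boot all_order all_algebra.
From mathcomp Require Import all_classical all_reals all_analysis.

Set Implicit Arguments.
Unset Strict Implicit.
Unset Printing Implicit Defensive.

Import Order.TTheory GRing.Theory Num.Theory.
Import numFieldNormedType.Exports.

Local Open Scope classical_set_scope.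
Local Open Scope ring_scope.

Definition eucl_dist (R : realType) (a b : R * R) : R :=
  Num.sqrt ((a.1 - b.1) ^+ 2 + (a.2 - b.2) ^+ 2).

Definition eucl_segment (R : realType) (a b : R * R) : set (R * R) :=
  [set ((1 - t) * a.1 + t * b.1, (1 - t) * a.2 + t * b.2) | t in `[0, 1]].

Section CAT0.
Context {R : realType} {X : metricType R}.
Implicit Types (x y z p q : X) (a b : R * R) (c : R -> X).

(* Only the values of c on [0, d(x, y)] matter. *)
Definition geodesic x y c : Prop :=
  [/\ c 0 = x, c (mdist x y) = y &
      forall s t, s \in `[0, mdist x y] -> t \in `[0, mdist x y] ->
        mdist (c s) (c t) = `|s - t|].

Definition geodesic_image x y c : set X := c @` `[0, mdist x y].

(* p lies on the side c from x to y of a geodesic triangle, and a is its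
   comparison point on the side [xb, yb] of the Euclidean triangle. *)
Definition comparison_point x y c (xb yb : R * R) p a : Prop :=
  [/\ geodesic_image x y c p, eucl_segment xb yb a &
      eucl_dist xb a = mdist x p].

Definition comparison_triangle x y z (xb yb zb : R * R) : Prop :=
  [/\ eucl_dist xb yb = mdist x y, eucl_dist yb zb = mdist y z &
      eucl_dist zb xb = mdist z x].

End CAT0.

Definition geodesic_space (R : realType) (X : metricType R) : Prop :=
  forall x y : X, exists c, geodesic x y c.

Definition CAT0_inequality (R : realType) (X : metricType R) : Prop :=
  forall (x y z : X) (cxy cyz czx : R -> X) (xb yb zb : R * R),
    geodesic x y cxy -> geodesic y z cyz -> geodesic z x czx ->
    comparison_triangle x y z xb yb zb ->
    let on_triangle p a :=
      [\/ comparison_point x y cxy xb yb p a,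
          comparison_point y z cyz yb zb p a |
          comparison_point z x czx zb xb p a] in
    forall p q a b, on_triangle p a -> on_triangle q b ->
      mdist p q <= eucl_dist a b.

HB.mixin Record Metric_isCAT0 (R : realType) X & Metric R X := {
  CAT0_geodesic : geodesic_space X ;
  CAT0_comparison : CAT0_inequality X
}.

#[short(type="hadamardType")]
HB.structure Definition Hadamard (R : realType) :=
  { X of Metric R X & Complete X & Metric_isCAT0 R X }.

Section Hadamard.
Context {R : realType} {X : hadamardType R}.
Implicit Types (x y z u : X) (C S : set X) (T : X -> X) (w : nat -> X).

(* In a CAT(0) space geodesics are unique, so the union below is over a single
   geodesic image. *)
Definition segment x y : set X :=
  [set z | exists2 c, geodesic x y c & geodesic_image x y c z].

(* oplus t x y is (1 - t) x (+) t y: the weight t belongs to the last point.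
   For t in [0, 1] the set is a singleton and the default x of xget is
   irrelevant. *)
Definition oplus (t : R) x y : X :=
  xget x [set z | [/\ segment x y z, mdist x z = t * mdist x y &
                      mdist y z = (1 - t) * mdist x y]].

Definition geo_convex C : Prop :=
  forall x y, C x -> C y -> segment x y `<=` C.

(* The set of nearest points is a singleton when S is nonempty, closed and
   convex. *)
Definition Proj S u : X :=
  xget u [set p | S p /\ forall q, S q -> mdist u p <= mdist u q].

Definition bounded_sequence w : Prop :=
  exists (p : X) (M : R), forall k, mdist p (w k) <= M.

Definition asymptotic_center w : set X :=
  [set x | forall y, (limn_esup (fun k => (mdist x (w k))%:E) <=
                      limn_esup (fun k => (mdist y (w k))%:E))%E].

Definition Delta_cvg w x : Prop :=
  bounded_sequence w /\
  forall phi : nat -> nat, {homo phi : m n / (m < n)%N} ->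
    asymptotic_center (w \o phi) = [set x].

(* A map T : C -> C is a total function on X with set_fun C C T; the notions
   below depend only on its values on C. *)

Definition fixed_points C T : set X := [set x | C x /\ T x = x].

Definition lipschitz_map C (alpha : R) T : Prop :=
  forall x y, C x -> C y -> mdist (T x) (T y) <= alpha * mdist x y.

Definition quasi_nonexpansive C T : Prop :=
  fixed_points C T !=set0 /\
  forall x q, C x -> fixed_points C T q -> mdist (T x) q <= mdist x q.

Definition demiclosed C T : Prop :=
  forall w x, (forall k, C (w k)) -> Delta_cvg w x ->
    mdist (w k) (T (w k)) @[k --> \oo] --> (0 : R) ->
    fixed_points C T x.

(* For T : C -> C alpha-Lipschitz with alpha > 1, C closed and convex, x in C
   and 0 < lam < 1 / (alpha - 1), the set is a singleton by the contraction
   principle. *)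
Definition resolvent C T (lam : R) x : X :=
  xget x [set y | C y /\ y = oplus (lam / (1 + lam)) x (T y)].

End Hadamard.

(* Main.v *)
Require Import Defs.
From mathcomp Require Import all_boot all_order all_algebra.
From mathcomp Require Import all_classical all_reals all_analysis.
From mathcomp Require Import ring lra.
Import Order.TTheory GRing.Theory Num.Theory.
Import numFieldNormedType.Exports.
Local Open Scope classical_set_scope.
Local Open Scope ring_scope.

(** Write p for the projection of u on F(T) and y_k for the resolvent of x_k.
    Stewart's inequality, read off from Euclidean comparison triangles, gives
    d(p, y_k)^2 <= d(p, x_k)^2 - sigma_k d(y_k, T y_k)^2 with
    sigma_k = lambda_k / (1 + lambda_k) bounded away from 0, and bounds
    s_k = d(p, x_k)^2 by
    s_{k+1} <= (1 - a_k) s_k + a_k (d(u, p)^2 - (1 - a_k) d(u, y_k)^2)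
               - (1 - a_k) sigma_k d(y_k, T y_k)^2.
    If d(y_k, T y_k) is not small, s decreases by a fixed amount. If it is
    small, then d(u, y_k) is at least almost d(u, p): otherwise a
    Delta-convergent sequence of almost fixed points would, by demiclosedness,
    yield a fixed point closer to u than p. As sum a_k = +oo, these two
    alternatives force s_k -> 0.

    Nearest points, fixed points of contractions and asymptotic centers are all
    obtained as Chebyshev centers of filters on X; a Delta-convergent
    subsequence is one whose asymptotic radius does not drop when passing to a
    further subsequence. *)

(** * Euclidean comparison triangles and Stewart's identity *)

Section EuclideanPlane.
Context {R : realType}.
Implicit Types (a b c : R * R).

Lemma eucl_dist_ge0 a b : 0 <= eucl_dist a b.
Proof. exact: sqrtr_ge0. Qed.

Lemma sqr_eucl_dist a b :
  eucl_dist a b ^+ 2 = (a.1 - b.1) ^+ 2 + (a.2 - b.2) ^+ 2.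
Proof. by rewrite sqr_sqrtr// addr_ge0// sqr_ge0. Qed.

Lemma eucl_dist_eq a b (r : R) : 0 <= r ->
  (a.1 - b.1) ^+ 2 + (a.2 - b.2) ^+ 2 = r ^+ 2 -> eucl_dist a b = r.
Proof. by move=> r0 ab; rewrite /eucl_dist ab sqrtr_sqr ger0_norm. Qed.

(** One vertex sits at the origin and the side of length [r] on the first axis; the law of cosines
    then fixes the third vertex up to reflection. The case [r = 0] is degenerate and needs its own
    triangle. *)
Lemma eucl_triangle_exists (p q r : R) : 0 <= p -> 0 <= q -> 0 <= r ->
    p <= q + r -> q <= p + r -> r <= p + q ->
  exists a b c,
    [/\ eucl_dist a b = r, eucl_dist b c = p & eucl_dist c a = q].
Proof.
move=> p0 q0; rewrite le_eqVlt => /predU1P[<-|r0] pqr qpr rpq.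
  have -> : p = q by lra.
  exists (0, 0), (0, 0), (q, 0).
  split; apply: eucl_dist_eq; rewrite ?lexx//=; ring.
(* The foot of the altitude on the side of length [r] *)
pose s := (q ^+ 2 + r ^+ 2 - p ^+ 2) / (2 * r).
have sE : 2 * r * s = q ^+ 2 + r ^+ 2 - p ^+ 2.
  by rewrite /s mulrC divfK// mulf_neq0// ?gt_eqF.
have s_le : s ^+ 2 <= q ^+ 2.
  rewrite -subr_ge0 -(pmulr_rge0 _ (_ : 0 < 4 * r ^+ 2)); last first.
    by rewrite mulr_gt0// exprn_gt0.
  (* Heron's factorization: the four resulting factors are the perimeter and the three
     triangle-inequality defects. *)
  have -> : 4 * r ^+ 2 * (q ^+ 2 - s ^+ 2)
      = (2 * r * q + (2 * r * s)) * (2 * r * q - (2 * r * s)) by ring.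
  rewrite sE; apply: mulr_ge0.
    have -> : 2 * r * q + (q ^+ 2 + r ^+ 2 - p ^+ 2)
      = (q + r + p) * (q + r - p) by ring.
    by apply: mulr_ge0; lra.
  have -> : 2 * r * q - (q ^+ 2 + r ^+ 2 - p ^+ 2)
    = (p + q - r) * (p + r - q) by ring.
  by apply: mulr_ge0; lra.
pose h := Num.sqrt (q ^+ 2 - s ^+ 2).
have hE : h ^+ 2 = q ^+ 2 - s ^+ 2 by rewrite sqr_sqrtr// subr_ge0.
exists (0, 0), (r, 0), (s, h); split; apply: eucl_dist_eq => //=.
- by rewrite ltW.
- by ring.
- transitivity (r ^+ 2 - 2 * r * s + s ^+ 2 + h ^+ 2); first by ring.
  by rewrite hE sE; ring.
- by rewrite !subr0 hE; ring.
Qed.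

Lemma eucl_stewart (t : R) a b c :
  let m := ((1 - t) * a.1 + t * b.1, (1 - t) * a.2 + t * b.2) in
  eucl_dist m c ^+ 2 = (1 - t) * eucl_dist c a ^+ 2 + t * eucl_dist b c ^+ 2
                       - t * (1 - t) * eucl_dist a b ^+ 2.
Proof. by rewrite /= !sqr_eucl_dist /=; ring. Qed.

Lemma eucl_dist_segment (t : R) a b : 0 <= t ->
  eucl_dist a ((1 - t) * a.1 + t * b.1, (1 - t) * a.2 + t * b.2)
  = t * eucl_dist a b.
Proof.
move=> t0; apply: eucl_dist_eq; first by rewrite mulr_ge0// eucl_dist_ge0.
by rewrite exprMn sqr_eucl_dist /=; ring.
Qed.

End EuclideanPlane.

(** * Stewart's inequality and geodesic combinations in CAT(0) spaces *)

Section CAT0Geometry.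
Context {R : realType} {X : hadamardType R}.
Implicit Types (x y z m u v : X) (C D : set X) (t r e : R).

Local Notation d := (@mdist R X).

Lemma ler_sqr_mdist x y r : 0 <= r -> d x y ^+ 2 <= r ^+ 2 -> d x y <= r.
Proof. by move=> r0; rewrite ler_sqr ?nnegrE ?mdist_ge0. Qed.

Lemma mdist_triangle_sym x y z : d y z <= d x y + d x z.
Proof. by rewrite (metric_sym x y) metric_triangle. Qed.

Lemma segment_dist x y m : segment x y m ->
  exists t, [/\ 0 <= t <= 1, d x m = t * d x y & d y m = (1 - t) * d x y].
Proof.
case=> c [c0 cxy cE] [s s01 <-].
have := s01; rewrite /= in_itv /= => /andP[s0 sd].
have xm : d x (c s) = s.
  rewrite -[in LHS]c0 cE//; last by rewrite in_itv/= lexx mdist_ge0.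
  by rewrite sub0r normrN ger0_norm.
have ym : d y (c s) = d x y - s.
  rewrite -[in LHS]cxy cE//; last by rewrite in_itv/= lexx mdist_ge0.
  by rewrite ger0_norm// subr_ge0.
have [d0|d0] := eqVneq (d x y) 0.
  by exists 0; rewrite xm ym lexx ler01 d0; split => //; lra.
have dgt0 : 0 < d x y by rewrite lt_def d0 mdist_ge0.
exists (s / d x y); split.
- by rewrite divr_ge0// ?mdist_ge0// ler_pdivrMr// mul1r.
- by rewrite divfK.
- by rewrite ym mulrBl mul1r divfK.
Qed.

(** The vertex [z] is compared as an endpoint of the side from [y] to [z], and [m] as a point of the
    side from [x] to [y]; the Euclidean distance of the comparison points is then given by Stewart's
    identity. *)
Lemma CAT0_stewart x y m z t : segment x y m -> 0 <= t <= 1 ->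
    d x m = t * d x y ->
  d z m ^+ 2 <= (1 - t) * d z x ^+ 2 + t * d z y ^+ 2
                - t * (1 - t) * d x y ^+ 2.
Proof.
case=> cxy gxy mxy /andP[t0 t1] xm.
have [cyz gyz] := CAT0_geodesic y z.
have [czx gzx] := CAT0_geodesic z x.
have [|||a [b [c [ab bc ca]]]] := @eucl_triangle_exists _ (d y z) (d z x)
    (d x y) (mdist_ge0 _ _) (mdist_ge0 _ _) (mdist_ge0 _ _).
- by rewrite addrC [d z x]metric_sym mdist_triangle_sym.
- by rewrite [d y z]metric_sym [d x y]metric_sym metric_triangle.
- by rewrite addrC [d z x]metric_sym [d y z]metric_sym metric_triangle.
pose n := ((1 - t) * a.1 + t * b.1, (1 - t) * a.2 + t * b.2).
have : d m z <= eucl_dist n c.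
  apply: (CAT0_comparison _ _ _ _ _ _ _ _ _ gxy gyz gzx (And3 ab bc ca)).
    apply: Or31; split => //; last by rewrite eucl_dist_segment// ab.
    by exists t => //=; rewrite in_itv/= t0.
  apply: Or32; split => //.
  - exists (d y z); first by rewrite /= in_itv/= mdist_ge0 lexx.
    by case: gyz.
  - exists 1; first by rewrite /= in_itv/= ler01 lexx.
    by case: (c) => c1 c2 /=; congr pair; ring.
rewrite -(@ler_pXn2r _ 2) ?nnegrE ?mdist_ge0 ?eucl_dist_ge0//.
by rewrite eucl_stewart ab bc ca (metric_sym m) (metric_sym y z).
Qed.

Lemma oplusP t x y : 0 <= t <= 1 ->
  [/\ segment x y (oplus t x y), d x (oplus t x y) = t * d x y &
      d y (oplus t x y) = (1 - t) * d x y].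
Proof.
move=> /andP[t0 t1]; rewrite /oplus; case: xgetP => [m _ []//|/=].
have [c gc] := CAT0_geodesic x y.
have [c0 c1 cE] := gc.
set s := t * d x y.
have s0 : 0 <= s by rewrite mulr_ge0 ?mdist_ge0.
have sd : s <= d x y by rewrite ler_piMl ?mdist_ge0.
have s_in : s \in `[0, d x y] by rewrite in_itv/= s0.
have [e0 e1] : 0 \in `[0, d x y] /\ d x y \in `[0, d x y].
  by rewrite !in_itv/= !lexx mdist_ge0.
move=> /(_ (c s))[]; split.
- by exists c => //; exists s.
- by rewrite -[in LHS]c0 cE// sub0r normrN ger0_norm.
- by rewrite -[in LHS]c1 cE// ger0_norm ?subr_ge0// mulrBl mul1r.
Qed.

Lemma oplus_stewart t x y z : 0 <= t <= 1 ->
  d z (oplus t x y) ^+ 2 <= (1 - t) * d z x ^+ 2 + t * d z y ^+ 2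
                            - t * (1 - t) * d x y ^+ 2.
Proof. by move=> t01; have [? ? _] := oplusP t x y t01; apply: CAT0_stewart. Qed.

(** Stewart's inequality is applied twice, with apex [y] and with apex [oplus t x z]; all terms in
    [d x y] and [d x z] cancel. This makes the map defining the resolvent a contraction. *)
Lemma oplus_dist_right t x y z : 0 <= t <= 1 ->
  d (oplus t x y) (oplus t x z) <= t * d y z.
Proof.
move=> t01; have [_ xz zz] := oplusP t x z t01.
have /andP[t0 t1] := t01.
apply: ler_sqr_mdist; first by rewrite mulr_ge0 ?mdist_ge0.
have := oplus_stewart t x z y t01; rewrite (metric_sym y x) => yz.
have := oplus_stewart t x y (oplus t x z) t01.
rewrite (metric_sym _ x) (metric_sym _ y) xz (metric_sym (oplus t x z)).
move=> /le_trans; apply.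
have := ler_wpM2l t0 yz; rewrite !exprMn => {}yz.
by lra.
Qed.

Lemma convex_oplus C t x y : geo_convex C -> 0 <= t <= 1 -> C x -> C y ->
  C (oplus t x y).
Proof.
move=> Cconv t01 Cx Cy; have [sxy _ _] := oplusP t x y t01.
exact: Cconv sxy.
Qed.

Lemma geo_convexT : geo_convex [set: X].
Proof. by []. Qed.

End CAT0Geometry.

(** * Chebyshev centers of filters *)

Lemma exists_sqr_gap {R : realType} (r c : R) : 0 <= r -> 0 < c ->
  exists2 e, 0 < e & 4 * ((r + e) ^+ 2 - r ^+ 2) < c.
Proof.
move=> r0 c0; have k0 : 0 < 8 * (2 * r + 1) by lra.
(* The cap 1 gives [(r + e) ^+ 2 - r ^+ 2 <= e * (2 * r + 1)], so four times the gap is at most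
   [c / 2]. *)
exists (Num.min 1 (c / (8 * (2 * r + 1)))); first by rewrite lt_min ltr01 divr_gt0.
set e := Num.min _ _.
have e0 : 0 <= e by rewrite le_min ler01 divr_ge0 ?ltW.
have e1 : e <= 1 by rewrite ge_min lexx.
have : e <= c / (8 * (2 * r + 1)) by rewrite ge_min lexx orbT.
rewrite ler_pdivlMr// => ec; nra.
Qed.

Section ChebyshevCenter.
Context {R : realType} {X : hadamardType R}.
Implicit Types (G : set_system X) (D : set X) (x y z u v : X) (r e : R).

Local Notation d := (@mdist R X).

(** For the tail filter of a bounded sequence and [D = setT] this is the asymptotic radius; for the
    principal filter at [u] and nonempty [D] it is the distance from [u] to [D]. *)
Definition chebyshev_radius G D : R :=
  inf [set r | exists2 x, D x & G [set z | d x z <= r]].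

Definition chebyshev_center G D v : Prop :=
  D v /\ forall e, 0 < e -> G [set z | d v z <= chebyshev_radius G D + e].

Lemma chebyshev_lbound G D : ProperFilter G ->
  lbound [set r | exists2 x, D x & G [set z | d x z <= r]] 0.
Proof.
move=> PG r /= [x _ /filter_ex[z /=]]; apply: le_trans; exact: mdist_ge0.
Qed.

Lemma chebyshev_radius_ge0 G D : ProperFilter G -> 0 <= chebyshev_radius G D.
Proof.
move=> PG; rewrite /chebyshev_radius; set E := (X in inf X).
have [E0|/nonemptyPn E0] := pselect (E !=set0).
  by apply: lb_le_inf => //; exact: chebyshev_lbound.
by rewrite E0 inf0.
Qed.

Lemma chebyshev_radius_le G D x r : ProperFilter G -> D x ->
  G [set z | d x z <= r] -> chebyshev_radius G D <= r.
Proof.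
move=> PG Dx Gx; apply: ge_inf; last by exists x.
by exists 0; exact: chebyshev_lbound.
Qed.

Lemma chebyshev_radius_sqr_le G D x r : ProperFilter G -> D x ->
  G [set z | d x z ^+ 2 <= r] -> chebyshev_radius G D ^+ 2 <= r.
Proof.
move=> PG Dx Gx; have [z /= zr] := filter_ex Gx.
have r0 : 0 <= r by apply: le_trans zr; exact: sqr_ge0.
rewrite -[leRHS](sqr_sqrtr r0) ler_sqr ?nnegrE ?sqrtr_ge0//.
  apply: (@chebyshev_radius_le _ _ x) => //.
  apply: filterS Gx => y /= yr; rewrite -(ger0_norm (mdist_ge0 x y)).
  by rewrite -sqrtr_sqr ler_wsqrtr.
exact: chebyshev_radius_ge0.
Qed.

Lemma half_itv01 : 0 <= (2^-1 : R) <= 1. Proof. by lra. Qed.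

(** By Stewart's inequality the midpoint of [x] and [y] admits the squared radius
    [r ^+ 2 - d x y ^+ 2 / 4], which cannot be below the optimal one. *)
Lemma almost_center_dist G D x y r : ProperFilter G -> geo_convex D ->
    D x -> D y -> G [set z | d x z <= r] -> G [set z | d y z <= r] ->
  d x y ^+ 2 <= 4 * (r ^+ 2 - chebyshev_radius G D ^+ 2).
Proof.
move=> PG Dconv Dx Dy Gx Gy.
suff : chebyshev_radius G D ^+ 2 <= r ^+ 2 - d x y ^+ 2 / 4 by lra.
apply: (@chebyshev_radius_sqr_le _ _ (oplus 2^-1 x y)) => //.
  exact: (convex_oplus _ _ _ _ Dconv half_itv01).
apply: filterS2 Gx Gy => z /= xz yz; rewrite metric_sym.
apply: (le_trans (oplus_stewart _ x y z half_itv01)).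
have := mdist_ge0 x z; have := mdist_ge0 y z.
rewrite (metric_sym z x) (metric_sym z y); nra.
Qed.

Lemma chebyshev_center_unique G D v w : ProperFilter G -> geo_convex D ->
  chebyshev_center G D v -> chebyshev_center G D w -> v = w.
Proof.
move=> PG Dconv [Dv Gv] [Dw Gw]; apply/eqP; rewrite -[_ == _]negbK.
apply/negP; rewrite -mdist_gt0 => vw.
have [|e e0] := @exists_sqr_gap _ (chebyshev_radius G D) (d v w ^+ 2)
  (chebyshev_radius_ge0 _ _ _); first by rewrite exprn_gt0.
by apply/negP; rewrite -leNgt; apply: almost_center_dist => //; [exact: Gv|exact: Gw].
Qed.

(** The sets of almost optimal centers are nested and, by [almost_center_dist], of diameter tending
    to 0, so they generate a Cauchy filter; its limit is the center. *)
Lemma chebyshev_center_exists G D y u r : ProperFilter G -> closed D ->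
    geo_convex D -> D y -> G [set z | d u z <= r] ->
  exists v, chebyshev_center G D v.
Proof.
move=> PG Dclosed Dconv Dy Gu; set rho := chebyshev_radius G D.
pose S e := [set x | D x /\ G [set z | d x z <= rho + e]].
have S0 e : 0 < e -> exists x, S e x.
  move=> e0; rewrite /S /rho /chebyshev_radius; set E := (X in inf X).
  have infE : has_inf E.
    split; last by exists 0; exact: chebyshev_lbound.
    exists (d y u + r), y => //; apply: filterS Gu => z /= uz.
    by apply: (le_trans (metric_triangle _ u _)); rewrite lerD2l.
  have [s [x Dx Gx] sE] := inf_adherent e0 infE.
  by exists x; split => //; apply: filterS Gx => z /= /le_trans; apply; exact: ltW.
pose F := filter_from [set e | 0 < e] S.
have PF : ProperFilter F.
  apply: filter_from_proper; last by move=> e /S0.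
  apply: filter_from_filter; first by exists 1 => /=.
  move=> e1 e2 /= e10 e20; exists (Num.min e1 e2); first by rewrite /= lt_min e10.
  move=> x [Dx Gx]; split; split => //; apply: filterS Gx => z /= /le_trans;
    apply; by rewrite lerD2l ge_min lexx ?orbT.
have Fcauchy : cauchy F.
  apply: cauchy_exP => e /= e0.
  have [|g g0 ge] := @exists_sqr_gap _ rho (e ^+ 2) (chebyshev_radius_ge0 _ _ _).
    by rewrite exprn_gt0.
  have [x [Dx Gx]] := S0 _ g0; exists x; exists g => // z [Dz Gz].
  rewrite ballEmdist /= -(@ltr_pXn2r _ 2) ?nnegrE ?mdist_ge0 ?ltW//.
  apply: le_lt_trans ge; exact: almost_center_dist.
have Fv : F --> lim F by exact: cauchy_cvg.
set v := lim F in Fv *; exists v; split.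
  apply: Dclosed => B /Fv FB.
  have FD : F D by exists 1 => [|x []] //; exact: ltr01.
  by have [x []] := filter_ex (filterI FD FB); exists x.
move=> e e0; have e20 : 0 < e / 2 by rewrite divr_gt0.
have FS : F (S (e / 2)) by exists (e / 2).
have [x [[Dx Gx] vx]] := filter_ex (filterI FS (Fv _ (nbhsx_ballx v _ e20))).
apply: filterS Gx => z /= xz; apply: (le_trans (metric_triangle _ x _)).
by move: vx; rewrite ballEmdist /= -/rho => vx; lra.
Qed.

(** If [v] were outside the ball, moving it slightly towards [u] would lower the squared radius by a
    positive amount. *)
Lemma chebyshev_center_ball G v u r : ProperFilter G ->
    chebyshev_center G setT v -> G [set z | d u z <= r] -> d u v <= r.
Proof.
move=> PG [_ Gv] Gu; set rho := chebyshev_radius G setT.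
have [w /= uw] := filter_ex Gu.
have r0 : 0 <= r by apply: le_trans uw; exact: mdist_ge0.
have rho0 : 0 <= rho by exact: chebyshev_radius_ge0.
apply: ler_sqr_mdist => //; rewrite leNgt; apply/negP.
set s := d u v ^+ 2 => rs.
have s0 : 0 < s by apply: le_lt_trans rs; exact: sqr_ge0.
(* This [t] maximizes the gain [t * ((1 - t) * s - r ^+ 2)] offered by Stewart's inequality. *)
pose t := (s - r ^+ 2) / (2 * s).
have tE : 2 * (t * s) = s - r ^+ 2.
  by rewrite /t -mulrA invfM; field; rewrite gt_eqF.
have t0 : 0 < t by apply: divr_gt0; rewrite ?subr_gt0// mulr_gt0.
have t1 : t <= 1.
  by rewrite -(ler_pM2r s0) mul1r; have := sqr_ge0 r; lra.
have t01 : 0 <= t <= 1 by rewrite ltW.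
pose c := t * ((1 - t) * s - r ^+ 2).
have c0 : 0 < c by rewrite mulr_gt0//; lra.
have [e e0 ec] := exists_sqr_gap rho c rho0 c0.
have : rho ^+ 2 <= (1 - t) * (rho + e) ^+ 2 + t * r ^+ 2 - t * (1 - t) * s.
  apply: (@chebyshev_radius_sqr_le _ _ (oplus t v u)) => //.
  apply: filterS2 (Gv e e0) Gu => z /= vz uz; rewrite metric_sym.
  apply: (le_trans (oplus_stewart t v u z t01)).
  rewrite [d v u]metric_sym -/s lerD2r (metric_sym z v) (metric_sym z u) lerD//.
    rewrite ler_wpM2l ?subr_ge0// ler_sqr ?nnegrE ?mdist_ge0//.
    by rewrite addr_ge0// ltW.
  by rewrite ler_wpM2l ?(ltW t0)// ler_sqr ?nnegrE ?mdist_ge0.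
have : t * rho ^+ 2 >= 0 by rewrite mulr_ge0 ?sqr_ge0 ?ltW.
have : (1 - t) * ((rho + e) ^+ 2 - rho ^+ 2) <= (rho + e) ^+ 2 - rho ^+ 2.
  by rewrite ler_piMl//; [nra|lra].
rewrite /c in ec c0; lra.
Qed.

End ChebyshevCenter.

(** * Real bounds from extended-real upper and lower limits *)

Section LimSup.
Context {R : realType}.
Implicit Types (f : nat -> R) (r : R).

Lemma limn_esup_EFin_le f r :
    (forall e, 0 < e -> \forall k \near \oo, f k <= r + e) ->
  (limn_esup (fun k => (f k)%:E) <= r%:E)%E.
Proof.
move=> fr; apply/lee_addgt0Pr => e e0.
apply: (@le_trans _ _ (ereal_sup
  ((fun k => (f k)%:E) @` [set k | f k <= r + e]))); last first.
  by apply: ge_ereal_sup => _ [k /= fk <-]; rewrite lee_fin.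
by apply: ereal_inf_lbound; exists [set k | f k <= r + e] => //; exact: fr.
Qed.

Lemma limn_esup_EFin_lt f r : (limn_esup (fun k => (f k)%:E) < r%:E)%E ->
  \forall k \near \oo, f k <= r.
Proof.
move=> /ereal_inf_lt[_ [V Voo <-] Vr]; apply: filterS Voo => k Vk.
by rewrite -lee_fin (le_trans _ (ltW Vr))//; apply: ereal_sup_ubound; exists k.
Qed.

Lemma limn_einf_EFin_gt0 f : (0 < limn_einf (fun k => (f k)%:E))%E ->
  exists2 l : R, 0 < l & \forall k \near \oo, l <= f k.
Proof.
rewrite /limn_einf oppe_gt0 => /ereal_inf_lt[_ [V Voo <-] Vr].
have sV k : V k -> ((- f k)%:E <=
    ereal_sup ((fun j => (\- (fun i => (f i)%:E)) j) @` V))%E.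
  by move=> Vk; apply: ereal_sup_ubound; exists k => //; rewrite EFinN.
move: Vr sV; case: (ereal_sup _) => [s|//|].
- rewrite lte_fin => s0 sV; exists (- s); first by rewrite oppr_gt0.
  by apply: filterS Voo => k /sV; rewrite lee_fin lerNl.
(* A supremum equal to [-oo] would force [V] to be empty, so the value 1 is arbitrary. *)
- move=> _ sV; exists 1; first exact: ltr01.
  by apply: filterS Voo => k /sV.
Qed.

End LimSup.

(** * Subsequences and Delta-compactness of bounded sequences *)

Lemma leq_increasing_seq (phi : nat -> nat) :
  {homo phi : m n / (m < n)%N} -> forall k, (k <= phi k)%N.
Proof.
by move=> phiI; elim=> [//|k IH]; apply: leq_ltn_trans IH (phiI _ _ (ltnSn k)).
Qed.

Lemma near_increasing_seq (phi : nat -> nat) (P : set nat) :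
  {homo phi : m n / (m < n)%N} -> (\forall k \near \oo, P k) ->
  \forall k \near \oo, P (phi k).
Proof.
move=> phiI [N _ NP]; exists N => // k /= Nk; apply: NP => /=.
exact: leq_trans (leq_increasing_seq _ phiI k).
Qed.

Section DeltaCompactness.
Context {R : realType} {X : hadamardType R}.
Implicit Types (G : set_system X) (w y : nat -> X) (A B : set nat) (v : X).

Local Notation d := (@mdist R X).

(** A finer filter admits more radii. The bound on [G] excludes the default value 0 of [inf] on the
    empty set. *)
Lemma chebyshev_radius_antitone G G' : ProperFilter G -> ProperFilter G' ->
    (exists v r, G [set z | d v z <= r]) -> G `<=` G' ->
  chebyshev_radius G' setT <= chebyshev_radius G setT.
Proof.
move=> PG PG' [v [r Gv]] GG'; apply: lb_le_inf; first by exists r, v.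
by move=> s /= [x _ Gx]; apply: (@chebyshev_radius_le _ _ _ _ x) => //; exact: GG'.
Qed.

Lemma chebyshev_radius_le_limsup y v :
  ((chebyshev_radius (y @ \oo) setT)%:E <= limn_esup (fun k => (d v (y k))%:E))%E.
Proof.
apply: le_ereal_inf_tmp => _ [V Voo <-].
have sV k : V k -> ((d v (y k))%:E <=
    ereal_sup ((fun j => (d v (y j))%:E) @` V))%E.
  by move=> Vk; apply: ereal_sup_ubound; exists k.
move: sV; case: (ereal_sup _) => [s||] sV; last 2 first.
- by rewrite leey.
- by have [k /sV] := filter_ex Voo.
rewrite lee_fin; apply: (@chebyshev_radius_le _ _ _ _ v) => //=.
by apply: filterS Voo => k /sV; rewrite lee_fin.
Qed.

(** The upper limit of the distances from [v] equals the Chebyshev radius, the least possible value;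
    any other minimizer is a Chebyshev center too, hence equal to [v]. *)
Lemma asymptotic_center_chebyshev y v :
  chebyshev_center (y @ \oo) setT v -> asymptotic_center y = [set v].
Proof.
move=> cv; have [_ Gv] := cv; rewrite /asymptotic_center.
have vr : (limn_esup (fun k => (d v (y k))%:E) <=
    (chebyshev_radius (y @ \oo) setT)%:E)%E.
  by apply: limn_esup_EFin_le => e /Gv.
apply/seteqP; split => [x xc|_ ->]/=; last first.
  by move=> z; apply: (le_trans vr); exact: chebyshev_radius_le_limsup.
apply: (chebyshev_center_unique _ _ _ _ _ geo_convexT _ cv); split => // e e0.
apply: limn_esup_EFin_lt; apply: (le_lt_trans (xc v)); apply: (le_lt_trans vr).
by rewrite lte_fin ltrDl.
Qed.

(** Infinite index sets stand for subsequences: nested subsequences become nested sets, with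
    [within A \oo] as tail filter. *)
Definition unbounded_set A : Prop := forall n, exists2 k, (n <= k)%N & A k.

Lemma within_unbounded_proper A : unbounded_set A ->
  ProperFilter (within A \oo).
Proof.
move=> uA; apply: Build_ProperFilter_ex => B [N _ NB].
by have [k Nk Ak] := uA N; exists k; exact: NB.
Qed.

Local Notation rad w A := (chebyshev_radius (w @ within A \oo) setT).

Lemma exists_almost_maximal_subset w A (e : R) : 0 < e -> unbounded_set A ->
  exists B, [/\ unbounded_set B, B `<=` A &
    forall B', unbounded_set B' -> B' `<=` A -> rad w B <= rad w B' + e].
Proof.
move=> e0 uA.
pose E := [set r | exists B, [/\ unbounded_set B, B `<=` A & r = rad w B]].
have lbE : lbound E 0.
  move=> _ [B [uB _ ->]].
  by have := within_unbounded_proper _ uB => PB; exact: chebyshev_radius_ge0.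
have infE : has_inf E by split; [exists (rad w A), A; split|exists 0].
have [_ [B [uB BA ->]] Be] := inf_adherent e0 infE.
exists B; split => // B' uB' BA'; apply/ltW/(lt_le_trans Be).
by rewrite lerD2r; apply: ge_inf; [exists 0|exists B'].
Qed.

(** Diagonal argument: each index set nearly minimizes the radius among the infinite subsets of its
    predecessor, with tolerance tending to 0, and [phi] runs diagonally through these sets. Any
    further subsequence lies eventually in each of them, so its radius cannot drop. *)
Lemma exists_regular_subsequence w (p : X) (M : R) :
    (forall k, d p (w k) <= M) ->
  exists2 phi : nat -> nat, {homo phi : m n / (m < n)%N} &
    forall psi : nat -> nat, {homo psi : m n / (m < n)%N} ->
      chebyshev_radius (w \o phi \o psi @ \oo) setT =
      chebyshev_radius (w \o phi @ \oo) setT.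
Proof.
move=> wM.
pose U := {A : set nat | unbounded_set A}.
have /choice[f fP] : forall nA : nat * U, exists B : U,
    sval B `<=` sval nA.2 /\ forall B', unbounded_set B' ->
    B' `<=` sval nA.2 -> rad w (sval B) <= rad w B' + nA.1.+1%:R^-1.
  move=> [n [A uA]] /=.
  have [|B [uB BA Bmax]] := @exists_almost_maximal_subset w A n.+1%:R^-1 _ uA.
    by rewrite invr_gt0.
  by exists (exist _ B uB).
have uT : unbounded_set setT by move=> n; exists n.
pose As := fix As n : U := if n is m.+1 then f (m, As m) else exist _ setT uT.
have As_decr m n : (m <= n)%N -> sval (As n) `<=` sval (As m).
  move=> /subnK <-; elim: (n - m)%N => [//|k IH].
  by rewrite addSn; apply: subset_trans IH => /=; exact: (fP (_, _)).1.
have /choice[g gP] : forall nm : nat * nat, exists k,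
    (nm.2 < k)%N /\ sval (As nm.1) k.
  by move=> [n m] /=; have [k mk Ak] := svalP (As n) m.+1; exists k.
pose phi := fix phi n := if n is m.+1 then g (n, phi m) else 0%N.
have phiI : {homo phi : m n / (m < n)%N}.
  apply: homo_ltn; first exact: ltn_trans.
  by move=> i /=; have [] := gP (i.+1, phi i).
have phiA n k : (n < k)%N -> sval (As n.+1) (phi k).
  case: k => // k nk; apply: (As_decr _ k.+1) => //=.
  by have [] := gP (k.+1, phi k).
exists phi => // psi psiI; apply/eqP; rewrite eq_le; apply/andP; split.
  apply: chebyshev_radius_antitone.
    by exists p, M; exists 0%N => // k _; exact: wM.
  by move=> B; exact: near_increasing_seq.
apply/ler_addgt0Pr => e e0.
have [n ne] : exists n, n.+1%:R^-1 < e :> R.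
  have [n _ ne] := near_infty_natSinv_lt (PosNum e0).
  by exists n; apply: ne => /=.
(* Dropping the first indices puts [B] inside [As n], where the near-minimality of [As n.+1]
   applies. The radii of [w \o phi], [As n.+1], [B] and [w \o phi \o psi] are then compared in this
   order. *)
pose B := [set phi (psi k) | k in [set k | (n < k)%N]].
have nphi k : (n < k)%N -> (n < psi k)%N.
  by move=> nk; apply: leq_trans (leq_increasing_seq _ psiI k).
have uB : unbounded_set B.
  move=> m; exists (phi (psi (maxn m n.+1))).
    apply: leq_trans (leq_maxl m n.+1) _.
    by apply: leq_trans (leq_increasing_seq _ psiI _) (leq_increasing_seq _ phiI _).
  by exists (maxn m n.+1) => //=; rewrite leq_max ltnSn orbT.
have BA : B `<=` sval (As n).
  by move=> _ [k nk <-]; apply: (As_decr _ n.+1) => //; apply/phiA/nphi.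
have PB := within_unbounded_proper _ uB.
have PA := within_unbounded_proper _ (svalP (As n.+1)).
have wb A : (w @ within A \oo) [set z | d p z <= M].
  by exists 0%N => // k _ _; exact: wM.
apply: (@le_trans _ _ (rad w (sval (As n.+1)))).
  apply: chebyshev_radius_antitone; first by exists p, M; exact: wb.
  move=> Q [N _ NQ]; exists (maxn N n.+1) => // k /=.
  rewrite geq_max => /andP[Nk nk]; apply: NQ; last exact: phiA.
  by apply: leq_trans (leq_increasing_seq _ phiI k).
apply: (@le_trans _ _ (rad w B + n.+1%:R^-1)); first exact: (fP (_, _)).2.
apply: lerD; last exact: ltW.
apply: chebyshev_radius_antitone.
  by exists p, M; exists 0%N => // k _; exact: wM.
move=> Q [N _ NQ]; exists (phi (psi N)) => // m /= Nm [k _ kE].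
have ppI : {homo phi \o psi : i j / (i < j)%N} by move=> i j ij; exact/phiI/psiI.
rewrite -kE; apply: NQ => /=; rewrite leqNgt; apply/negP => /ppI /=.
by rewrite kE ltnNge Nm.
Qed.

(** Along a regular subsequence the radius is constant under thinning, so one center serves all
    further subsequences. *)
Lemma exists_Delta_cvg_subsequence w (p : X) (M : R) :
    (forall k, d p (w k) <= M) ->
  exists phi : nat -> nat, exists v, [/\ {homo phi : m n / (m < n)%N},
    chebyshev_center (w \o phi @ \oo) setT v & Delta_cvg (w \o phi) v].
Proof.
move=> wM; have [phi phiI phiR] := exists_regular_subsequence _ _ _ wM.
have [v vc] : exists v, chebyshev_center (w \o phi @ \oo) setT v.
  apply: (@chebyshev_center_exists _ _ _ _ p p M) => //.
  by exists 0%N => // k _; exact: wM.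
exists phi, v; split => //; split; first by exists p, M => k; exact: wM.
move=> psi psiI; apply: asymptotic_center_chebyshev; split => // e e0.
rewrite phiR//; have := vc.2 e e0; exact: near_increasing_seq.
Qed.

End DeltaCompactness.

(** * Projections, fixed point sets and resolvents *)

Section FixedPoints.
Context {R : realType} {X : hadamardType R}.
Implicit Types (C D : set X) (T f : X -> X) (x y u p q v : X) (r s t : R).

Local Notation d := (@mdist R X).

Lemma Proj_nearest D u : closed D -> geo_convex D -> D !=set0 ->
  D (Proj D u) /\ forall q, D q -> d u (Proj D u) <= d u q.
Proof.
move=> Dclosed Dconv [y Dy]; rewrite /Proj; case: xgetP => [//|/=].
(* A Chebyshev center in [D] of the principal filter at [u] is a nearest point to [u]. *)
pose G : set_system X := globally [set u].
have PG : ProperFilter G by exact: globally_properfilter.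
have [|v [Dv Gv]] := @chebyshev_center_exists _ _ G D y u 0 PG Dclosed Dconv Dy.
  by move=> z /= ->; rewrite mdistxx lexx.
move=> /(_ v)[]; split => // q Dq; apply/ler_addgt0Pr => e e0.
rewrite metric_sym; apply: le_trans (Gv e e0 u erefl) _; rewrite lerD2r.
by apply: (@chebyshev_radius_le _ _ _ _ q) => // z /= ->; rewrite metric_sym.
Qed.

(** Applying [f] to a center of the orbit yields a center of the shifted orbit, which has the same
    tail filter; uniqueness of centers makes it fixed. *)
Lemma contraction_fixed_point C f (k : R) : closed C -> geo_convex C ->
    C !=set0 -> set_fun C C f -> 0 <= k < 1 ->
    (forall x y, C x -> C y -> d (f x) (f y) <= k * d x y) ->
  exists2 v, C v & f v = v.
Proof.
move=> Cclosed Cconv [z Cz] fC /andP[k0 k1] fk.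
pose w n := iter n f z.
have Cw n : C (w n) by elim: n => //= n; exact: fC.
(* [M] solves [d z (f z) + k * M = M], which closes the induction bounding the orbit. *)
pose M := d z (f z) / (1 - k).
have ME : d z (f z) + k * M = M.
  by rewrite /M; field; rewrite subr_eq0 eq_sym lt_eqF.
have M0 : 0 <= M by rewrite divr_ge0 ?mdist_ge0// subr_ge0 ltW.
have wM n : d z (w n) <= M.
  elim: n => [|n IH]; first by rewrite mdistxx.
  apply: (le_trans (metric_triangle _ (f z) _)); rewrite -ME lerD2l.
  by apply: (le_trans (fk _ _ Cz (Cw n))); rewrite ler_wpM2l.
have [|v vc] := @chebyshev_center_exists _ _ (w @ \oo) C z z M _ Cclosed Cconv Cz.
  by exists 0%N => // n _; exact: wM.
have [Cv Gv] := vc; exists v => //.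
apply: (chebyshev_center_unique _ _ _ _ _ Cconv _ vc).
split; first exact: fC.
move=> e e0; have [N _ Nv] := Gv e e0; exists N.+1 => // -[//|n] /= Nn.
apply: (le_trans (fk _ _ Cv (Cw n))); apply: le_trans (Nv n Nn).
by rewrite ler_piMl ?mdist_ge0// ltW.
Qed.

Lemma fixed_points_closed C T : closed C -> quasi_nonexpansive C T ->
  closed (fixed_points C T).
Proof.
move=> Cclosed [_ Tq] x xF.
have Cx : C x by apply: Cclosed => B /xF[y [[Cy _] By]]; exists y.
split => //; apply/eqP; rewrite -[_ == _]negbK -mdist_gt0; apply/negP => dx.
have d20 : 0 < d (T x) x / 2 by rewrite divr_gt0.
have [q [Fq]] := xF _ (nbhsx_ballx x _ d20); rewrite ballEmdist /= => xq.
have := metric_triangle (T x) q x; have := Tq x q Cx Fq.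
by rewrite (metric_sym q x); lra.
Qed.

(** With apex [T z], quasi-nonexpansiveness bounds Stewart's right-hand side by [t * (1 - t) * (t +
    (1 - t) - 1) * d x y ^+ 2], which is 0. *)
Lemma fixed_points_convex C T : geo_convex C -> quasi_nonexpansive C T ->
  geo_convex (fixed_points C T).
Proof.
move=> Cconv [_ Tq] x y Fx Fy z xyz.
have Cz : C z by apply: Cconv xyz; [case: Fx|case: Fy].
split => //; apply: mdist_positivity; apply/eqP; rewrite eq_le mdist_ge0 andbT.
have [t [t01 xz yz]] := segment_dist _ _ _ xyz.
apply: ler_sqr_mdist => //; apply: (le_trans (CAT0_stewart _ _ _ (T z) _ xyz t01 xz)).
have /andP[t0 t1] := t01.
have : d (T z) x ^+ 2 <= (t * d x y) ^+ 2.
  by rewrite -xz (metric_sym x) ler_sqr ?nnegrE ?mdist_ge0//; exact: Tq.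
have : d (T z) y ^+ 2 <= ((1 - t) * d x y) ^+ 2.
  by rewrite -yz (metric_sym y) ler_sqr ?nnegrE ?mdist_ge0//; exact: Tq.
move=> /(ler_wpM2l t0) ty /(ler_wpM2l (_ : 0 <= 1 - t)); rewrite subr_ge0.
move=> /(_ t1) tx; apply: le_trans (lerD (lerD tx ty) (lexx _)) _.
by rewrite expr0n /= le_eqVlt; apply/orP; left; apply/eqP; ring.
Qed.

Lemma resolventP C T (alpha lam : R) x : closed C -> geo_convex C ->
    1 < alpha -> set_fun C C T -> lipschitz_map C alpha T ->
    0 < lam < 1 / (alpha - 1) -> C x ->
  C (resolvent C T lam x) /\
  resolvent C T lam x = oplus (lam / (1 + lam)) x (T (resolvent C T lam x)).
Proof.
move=> Cclosed Cconv alpha1 TC Tlip /andP[lam0 lam1] Cx.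
rewrite /resolvent; case: xgetP => [//|/=].
set s := lam / (1 + lam) => noroot.
have l10 : 0 < 1 + lam by rewrite addr_gt0.
have s01 : 0 <= s <= 1.
  by rewrite ler_pdivrMr// mul1r lerDr ler01 divr_ge0// ltW.
have /andP[s0 s1] := s01.
(* The upper bound is [lam * (alpha - 1) < 1] rearranged. *)
have sa : 0 <= s * alpha < 1.
  have alpha0 : 0 <= alpha by rewrite ltW// (lt_trans ltr01).
  rewrite mulr_ge0//= /s mulrAC ltr_pdivrMr// mul1r.
  by move: lam1; rewrite ltr_pdivlMr ?subr_gt0//; lra.
have [|||v Cv vE] := @contraction_fixed_point C (fun y => oplus s x (T y)) _
    Cclosed Cconv _ _ sa.
- by exists x.
- by move=> y Cy; apply: convex_oplus => //; exact: TC.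
- move=> y z Cy Cz; apply: (le_trans (oplus_dist_right _ _ _ _ s01)).
  by rewrite -mulrA ler_wpM2l// Tlip.
by have [] := noroot v.
Qed.

(** Stewart's inequality at [y], with [d p (T y) <= d p y], is divided by [1 - s]; this leaves
    [s * d x (T y) ^+ 2], and [d y (T y)] is [1 - s] times [d x (T y)]. *)
Lemma resolvent_quasi_contractive C T s x y p : quasi_nonexpansive C T ->
    C y -> fixed_points C T p -> 0 < s < 1 -> y = oplus s x (T y) ->
  d p y ^+ 2 <= d p x ^+ 2 - s * d y (T y) ^+ 2.
Proof.
move=> [_ Tq] Cy Fp /andP[s0 s1] yE.
have s01 : 0 <= s <= 1 by rewrite !ltW.
have := oplus_stewart s x (T y) p s01; rewrite -yE.
have [_ _] := oplusP s x (T y) s01; rewrite -yE (metric_sym (T y)) => ->.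
have : d p (T y) ^+ 2 <= d p y ^+ 2.
  rewrite (metric_sym p (T y)) (metric_sym p y).
  by rewrite ler_sqr ?nnegrE ?mdist_ge0//; exact: Tq.
rewrite exprMn; set A := d p (T y) ^+ 2; set B := d p y ^+ 2.
set E := d p x ^+ 2; set W := d x (T y) ^+ 2 => AB BE.
have W0 : 0 <= W by rewrite sqr_ge0.
have BW : B <= E - s * W.
  rewrite -(@ler_pM2l _ (1 - s)) ?subr_gt0//.
  have := ler_wpM2l (ltW s0) AB; lra.
have : s * ((1 - s) ^+ 2 * W) <= s * W.
  by rewrite ler_pM2l// ler_piMl// expr_le1// ?subr_ge0 ?gerBl ltW.
lra.
Qed.

(* Bounded almost fixed points have Delta-cluster points in F(T), and closed
   balls around u are closed under Delta-limits. *)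
Lemma almost_fixed_points_far C T u r : demiclosed C T ->
    (forall q, fixed_points C T q -> r < d u q) ->
  exists2 tau, 0 < tau & forall y, C y -> d y (T y) <= tau -> r < d u y.
Proof.
move=> Tdemi rF; apply: contrapT => notau.
have /choice[w wP] : forall n, exists y,
    [/\ C y, d y (T y) <= n.+1%:R^-1 & d u y <= r].
  move=> n; apply: contrapT => now; apply: notau.
  exists n.+1%:R^-1; first by rewrite invr_gt0.
  move=> y Cy yT; rewrite ltNge; apply/negP => uy.
  by apply: now; exists y.
have [|phi [v [phiI vc wv]]] := @exists_Delta_cvg_subsequence _ _ w u r.
  by move=> n; have [] := wP n.
have Fv : fixed_points C T v.
  apply: Tdemi wv _; first by move=> k; have [] := wP (phi k).
  apply/cvgr0Pnorm_lt => e e0.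
  apply: (near_increasing_seq phi
    [set n | `|d (w n) (T (w n))| < e] phiI).
  apply: filterS (near_infty_natSinv_lt (PosNum e0)) => n /= ne.
  by rewrite ger0_norm ?mdist_ge0//; apply: le_lt_trans ne; have [] := wP n.
have : d u v <= r.
  apply: (chebyshev_center_ball _ _ _ _ _ vc).
  by exists 0%N => // k _ /=; have [] := wP (phi k).
by rewrite leNgt rF.
Qed.

End FixedPoints.

(** * Null sequences from a two-case recursion *)

(** Eventually [a k * e <= delta], so while [s k > 2 * e] both alternatives lower [s] by at least
    [e * a k]; divergence of the sum forbids this forever. Once [s k <= 2 * e], both alternatives
    preserve this bound. *)
Lemma cvg0_of_recursion {R : realType} (s a : nat -> R) :
    (forall k, 0 <= s k) -> (forall k, (1 <= k)%N -> 0 < a k < 1) ->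
    a @ \oo --> 0 -> (\sum_(1 <= k <oo) (a k)%:E = +oo)%E ->
    (forall e, 0 < e -> exists2 delta, 0 < delta & \forall k \near \oo,
      s k.+1 <= s k - delta \/ s k.+1 <= (1 - a k) * s k + a k * e) ->
  s @ \oo --> 0.
Proof.
move=> s0 a01 acvg asum srec; apply/cvgr0Pnorm_le => e' e'0.
pose e := e' / 2; have e0 : 0 < e by rewrite divr_gt0.
have [dl dl0 sd] := srec e e0.
have /cvgr0Pnorm_le/(_ (dl / e)) := acvg; rewrite divr_gt0// => /(_ isT) ad.
have [N _ NP] : \forall k \near \oo, [/\ (1 <= k)%N, a k * e <= dl &
    s k.+1 <= s k - dl \/ s k.+1 <= (1 - a k) * s k + a k * e].
  near=> k; have k1 : (1 <= k)%N by near: k; exists 1%N.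
  split => //; last by near: k.
  have /andP[ak0 _] := a01 k k1.
  by rewrite -ler_pdivlMr// -(ger0_norm (ltW ak0)); near: k.
have step k : (N <= k)%N -> 2 * e < s k -> s k.+1 <= s k - e * a k.
  move=> /NP[k1 ake []]; first by lra.
  by have /andP[ak0 ak1] := a01 k k1; nra.
have [m Nm sm] : exists2 m, (N <= m)%N & s m <= 2 * e.
  apply: contrapT => nom.
  have big k : (N <= k)%N -> 2 * e < s k.
    by move=> Nk; rewrite ltNge; apply/negP => sk; apply: nom; exists k.
  have partial n : e * \sum_(N <= k < N + n) a k <= s N - s (N + n)%N.
    elim: n => [|n IH]; first by rewrite addn0 big_geq// mulr0 subrr.
    rewrite addnS big_nat_recr ?leq_addr//= mulrDr.
    by have := step (N + n)%N (leq_addr _ _) (big _ (leq_addr _ _)); lra.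
  have [N1 _ _] := NP N (leqnn N).
  suff : (\sum_(1 <= k <oo) (a k)%:E <=
      (\sum_(1 <= k < N) a k + s N / e)%:E)%E by rewrite asum.
  apply: lime_le.
    apply: is_cvg_nneseries => k k1 _; rewrite lee_fin.
    by have /andP[/ltW] := a01 k k1.
  exists N => // n /= Nn; rewrite sumEFin lee_fin (big_cat_nat N1 Nn)/= lerD2l.
  rewrite ler_pdivlMr// mulrC; have := partial (n - N)%N.
  by rewrite subnKC// => /le_trans; apply; rewrite gerBl.
have stay k : s (m + k)%N <= 2 * e.
  elim: k => [|k IH]; first by rewrite addn0.
  rewrite addnS; have mk : (N <= m + k)%N by rewrite (leq_trans Nm) ?leq_addr.
  have [k1 _ []] := NP _ mk; first by lra.
  by have /andP[ak0 ak1] := a01 _ k1; nra.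
exists m => // k /= mk; rewrite ger0_norm// -(subnKC mk).
by apply: le_trans (stay _) _; rewrite /e mulrC divfK.
Unshelve. all: by end_near.
Qed.

(** * Strong convergence of the Halpern iteration of resolvents *)

Theorem theorem3p19 (R : realType) (X : hadamardType R) (C : set X)
    (alpha : R) (T : X -> X) (lam : nat -> R) (u : X) (a : nat -> R)
    (x : nat -> X)
    (C_closed : closed C) (C_convex : geo_convex C)
    (alpha_gt1 : 1 < alpha)
    (T_maps : set_fun C C T)
    (T_lipschitz : lipschitz_map C alpha T)
    (T_demiclosed : demiclosed C T)
    (T_qne : quasi_nonexpansive C T)
    (lam_bounds : forall k, (1 <= k)%N -> 0 < lam k < 1 / (alpha - 1))
    (lam_liminf : (0 < limn_einf (fun k => (lam k)%:E))%E)
    (u_in_C : C u) (x1_in_C : C (x 1%N))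
    (a_bounds : forall k, (1 <= k)%N -> 0 < a k < 1)
    (a_cvg0 : a k @[k --> \oo] --> (0 : R))
    (a_sum : (\sum_(1 <= k <oo) (a k)%:E = +oo)%E)
    (x_step : forall k, (1 <= k)%N ->
      x k.+1 = oplus (1 - a k) u (resolvent C T (lam k) (x k))) :
  x k @[k --> \oo] --> Proj (fixed_points C T) u.
Proof.
set F := fixed_points C T; set p := Proj F u.
have [Fp pmin] : F p /\ forall q, F q -> mdist u p <= mdist u q.
  apply: Proj_nearest T_qne.1; first exact: fixed_points_closed.
  exact: fixed_points_convex.
pose y k := resolvent C T (lam k) (x k).
pose sg k := lam k / (1 + lam k).
have sg01 k : (1 <= k)%N -> 0 < sg k < 1.
  move=> /lam_bounds/andP[l0 _]; have l10 : 0 < 1 + lam k by rewrite addr_gt0.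
  by rewrite divr_gt0//= ltr_pdivrMr// mul1r ltrDr.
have a01 k : (1 <= k)%N -> 0 <= 1 - a k <= 1.
  by move=> /a_bounds/andP[a0 a1]; rewrite subr_ge0 gerBl !ltW.
have xC k : (1 <= k)%N -> C (x k).
  elim: k => [//|[//|k] IH _]; rewrite x_step//.
  apply: convex_oplus => //; first exact: a01.
  by have [] := resolventP _ _ _ _ _ C_closed C_convex alpha_gt1 T_maps
    T_lipschitz (lam_bounds k.+1 isT) (IH isT).
have yP k : (1 <= k)%N -> C (y k) /\ y k = oplus (sg k) (x k) (T (y k)).
  by move=> k1; apply: resolventP alpha_gt1 _ _ (lam_bounds k k1) (xC k k1).
have halpern k : (1 <= k)%N -> mdist p (x k.+1) ^+ 2 <=
    a k * mdist u p ^+ 2 + (1 - a k) * (mdist p (x k) ^+ 2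
      - sg k * mdist (y k) (T (y k)) ^+ 2) - a k * (1 - a k) * mdist u (y k) ^+ 2.
  move=> k1; rewrite x_step// -/(y k).
  apply: (le_trans (oplus_stewart _ _ _ _ (a01 k k1))); rewrite (metric_sym p u).
  have [Cy yE] := yP k k1; have /andP[b0 _] := a01 k k1.
  have := resolvent_quasi_contractive _ _ _ _ _ _ T_qne Cy Fp (sg01 k k1) yE.
  by move=> /(ler_wpM2l b0); lra.
suff : (fun k => mdist p (x k) ^+ 2) @ \oo --> 0.
  move=> /cvgr0Pnorm_lt xp; apply/cvg_ballP => e e0.
  have := xp _ (exprn_gt0 2 e0); apply: filterS => k /=.
  rewrite ger0_norm ?sqr_ge0// ballEmdist /=.
  by rewrite ltr_pXn2r ?nnegrE ?mdist_ge0// ltW.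
have [l l0 lam_ge] := limn_einf_EFin_gt0 _ lam_liminf.
(* An eventual lower bound for [sg], since [l / (1 + l)] increases with [l]. *)
pose c := l / (1 + l).
have l10 : 0 < 1 + l by rewrite addr_gt0.
have c0 : 0 < c by rewrite divr_gt0.
have sg_ge : \forall k \near \oo, c <= sg k.
  apply: filterS lam_ge => k lk; have lk0 : 0 < 1 + lam k by lra.
  rewrite /c /sg ler_pdivrMr// mulrAC ler_pdivlMr//; nra.
apply: (cvg0_of_recursion _ a) => // [k|e e0]; first exact: sqr_ge0.
set P := mdist u p ^+ 2; have P0 : 0 <= P by exact: sqr_ge0.
have aP h : 0 < h -> \forall k \near \oo, a k * P <= h.
  move=> h0; have P10 : 0 < P + 1 by rewrite ltr_wpDl.
  have /cvgr0Pnorm_le/(_ (h / (P + 1))) := a_cvg0.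
  rewrite divr_gt0// => /(_ isT); apply: filterS2 (nbhs_infty_ge 1) => k k1.
  have /andP[ak0 _] := a_bounds k k1; rewrite (ger0_norm (ltW ak0)).
  by rewrite ler_pdivlMr//; nra.
have a_half : \forall k \near \oo, a k <= 2^-1.
  have /cvgr0Pnorm_le/(_ 2^-1) := a_cvg0; rewrite invr_gt0 => /(_ (ltr0n _ 2)).
  by apply: filterS => k; apply: le_trans; exact: ler_norm.
(* If [P <= e], the second alternative holds outright and the decrement 1 is arbitrary. Otherwise
   [P - e / 2] is nonnegative and its root serves as a radius below [d(u, F)]. *)
have [Pe|eP] := leP P e.
  exists 1 => //; apply: filterS (nbhs_infty_ge 1) => k k1; right.
  apply: (le_trans (halpern k k1)).
  have /andP[b0 b1] := a01 k k1; have /andP[/ltW sk0 _] := sg01 k k1.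
  have /andP[ak0 _] := a_bounds k k1; have a0 := ltW ak0.
  have : 0 <= (1 - a k) * (sg k * mdist (y k) (T (y k)) ^+ 2).
    by apply: mulr_ge0 => //; apply: mulr_ge0 => //; exact: sqr_ge0.
  have : 0 <= a k * (1 - a k) * mdist u (y k) ^+ 2.
    by apply: mulr_ge0; [exact: mulr_ge0|exact: sqr_ge0].
  have : a k * P <= a k * e by rewrite ler_pM2l.
  by rewrite -/P; lra.
have Pe0 : 0 <= P - e / 2 by lra.
have rP q : F q -> Num.sqrt (P - e / 2) < mdist u q.
  move=> /pmin; apply: lt_le_trans.
  rewrite -(@ltr_pXn2r _ 2) ?nnegrE ?mdist_ge0 ?sqrtr_ge0//.
  by rewrite sqr_sqrtr// -/P; lra.
have [tau tau0 far] := almost_fixed_points_far _ _ _ _ T_demiclosed rP.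
have ct0 : 0 < c * tau ^+ 2 / 4 by rewrite divr_gt0// mulr_gt0// exprn_gt0.
(* When [d(y_k, T y_k) > tau], the drop is at least [c * tau ^+ 2 / 2] because [a k <= 1 / 2], and
   the term [a k * P] gives back at most half of it. *)
exists (c * tau ^+ 2 / 4) => //.
have e20 : 0 < e / 2 by rewrite divr_gt0.
near=> k; have k1 : (1 <= k)%N by near: k; exact: nbhs_infty_ge.
have /andP[b0 b1] := a01 k k1; have /andP[/ltW sk0 _] := sg01 k k1.
have /andP[ak0 _] := a_bounds k k1; have a0 := ltW ak0.
have [Cy _] := yP k k1.
have h := halpern k k1.
have [yT|yT] := leP (mdist (y k) (T (y k))) tau; [right|left].
- have := far _ Cy yT; rewrite -(@ltr_pXn2r _ 2) ?nnegrE ?mdist_ge0 ?sqrtr_ge0//.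
  rewrite sqr_sqrtr// => uy; apply: (le_trans h); rewrite -/P.
  (* The error [a k * (P - (1 - a k) * (P - e / 2))] equals [a k * (a k * P + (1 - a k) * (e / 2))],
     hence is at most [a k * e]. *)
  have ake : a k * P <= e / 2 by near: k; exact: aP.
  have : 0 <= (1 - a k) * (sg k * mdist (y k) (T (y k)) ^+ 2).
    by apply: mulr_ge0 => //; apply: mulr_ge0 => //; exact: sqr_ge0.
  have : a k * (1 - a k) * (P - e / 2) <= a k * (1 - a k) * mdist u (y k) ^+ 2.
    by rewrite ler_wpM2l ?mulr_ge0// ltW.
  have : a k * (a k * P) <= a k * (e / 2) by rewrite ler_pM2l.
  have : 0 <= a k * (a k * (e / 2)) by apply: mulr_ge0 => //; apply: mulr_ge0 => //; exact: ltW.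
  lra.
- apply: (le_trans h); rewrite -/P.
  have akc : a k * P <= c * tau ^+ 2 / 4 by near: k; exact: aP.
  have ak2 : a k <= 2^-1 by near: k.
  have ck : c <= sg k by near: k.
  have : 0 <= a k * (1 - a k) * mdist u (y k) ^+ 2.
    by apply: mulr_ge0; [exact: mulr_ge0|exact: sqr_ge0].
  have : 0 <= a k * mdist p (x k) ^+ 2 by rewrite mulr_ge0 ?sqr_ge0.
  have : c * tau ^+ 2 <= sg k * mdist (y k) (T (y k)) ^+ 2.
    by apply: ler_pM; rewrite ?sqr_ge0 ?ler_sqr ?nnegrE ?mdist_ge0// ltW.
  nra.
Unshelve. all: by end_near.
Qed.
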